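(* Let $\mathfrak g=\mathfrak{sl}(2)$, let $\theta$ be the trivial involution of $\mathfrak g$ ($\theta(H)=H$, $\theta(E^\pm)=E^\pm$, so $\theta(\mathfrak g)=\mathfrak g$), and let $\bar\theta$ be the nontrivial involution of $\mathcal{Y}(\mathfrak g)$ extending $\theta$ with $\bar\theta(\widehat H)=-\widehat H$, $\bar\theta(\widehat E^\pm)=-\widehat E^\pm$, $\bar\theta(\alpha)=-\alpha$. Then the twisted Yangian $\mathcal{Y}(\mathfrak g,\mathfrak g)$ of type II is the $\bar\theta$-fixed coideal subalgebra of $\mathcal{Y}(\mathfrak g)$ generated by all level-zero generators and the level-two twisted Yangian generators $$\widetilde{\widetilde E}{}^\pm=\pm\frac12\Big([\widehat H,\widehat E^\pm]+\alpha\big(\pm t\,\widehat E^\pm+H\widehat E^\pm-E^\pm\widehat H\big)\Big)\qquad\text{and}\qquad \widetilde{\widetilde H}=[\widetilde{\widetilde E}{}^+,E^-],$$ where $t\in\mathbb{C}$ is an arbitrary complex number.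
   Context: $\mathcal{Y}(\mathfrak{sl}(2))$ is the Yangian (Drinfeld's first realization), where $\alpha$ is a formal level-one deformation parameter. It is generated by the level-zero generators $E^\pm,H$ and level-one generators $\widehat E^\pm,\widehat H$, with $[H,E^\pm]=\pm2E^\pm$, $[E^+,E^-]=H$, $[H,\widehat E^\pm]=\pm2\widehat E^\pm$, $[E^\pm,\widehat E^\mp]=\pm\widehat H$, $[H,\widehat H]=0$ (more generally, level-one generators transform in the adjoint representation of the level-zero ones), and Drinfeld's Serre-type relation for $\mathfrak{sl}(2)$, whose right-hand side is proportional to $\alpha^2$. Coproduct: $\Delta(x)=x\otimes1+1\otimes x$ for $x\in\{E^\pm,H\}$, $$\Delta(\widehat H)=\widehat H\otimes1+1\otimes\widehat H-\alpha(E^+\otimes E^--E^-\otimes E^+),$$ $$\Delta(\widehat E^\pm)=\widehat E^\pm\otimes1+1\otimes\widehat E^\pm\pm\frac{\alpha}{2}(E^\pm\otimes H-H\otimes E^\pm).$$ ''Coideal'' means left coideal: $\Delta(b)\in\mathcal{Y}(\mathfrak g)\otimes\mathcal B$ for all $b$ in the subalgebra $\mathcal B$. Twisted Yangian of type II in general: let $\theta$ be the trivial involution of $\mathfrak g$, extended to $\mathcal Y(\mathfrak g)$ by $\bar\theta(\widehat j^{\,a})=-\widehat j^{\,a}$, $\bar\theta(\widehat{\widehat j}{}^{\,a})=\widehat{\widehat j}{}^{\,a}$, $\bar\theta(\alpha)=-\alpha$, where $\widehat{\widehat j}{}^{\,a}=\frac1{c_{\mathfrak g}}f^a{}_{bc}[\widehat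 j^{\,c},\widehat j^{\,b}]$ are the level-two generators, $f$ the structure constants and $c_{\mathfrak g}$ the eigenvalue of the quadratic Casimir in the adjoint representation. The involution $\bar\theta$, combined with the requirement that the $\bar\theta$-fixed subalgebra satisfy the left coideal property, defines the twisted Yangian $\mathcal Y(\mathfrak g,\mathfrak g)$. It is the left coideal subalgebra of $\mathcal Y(\mathfrak g)$ generated by the level-zero generators $j^a$ and the twisted level-two generators $\widehat{\widehat j}{}^{\,a}+\alpha\,t\,\widehat j^{\,a}+\frac{\alpha}{4}f^a{}_{bc}(\widehat j^{\,b}j^c+j^c\widehat j^{\,b})$, where $t\in\mathbb C$ is arbitrary (the parameter $t$ here and the one in the claim are normalized differently). *)

(* Defs.v *)
From HB Require Import structures.
From mathcomp Require Import all_boot all_order all_algebra.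
From mathcomp Require Import complex ring.
From mathcomp Require Import boolp classical_sets reals.

Set Implicit Arguments.
Unset Strict Implicit.
Unset Printing Implicit Defensive.

Import Order.TTheory GRing.Theory Num.Theory.
Local Open Scope quotient_scope.
Local Open Scope classical_set_scope.
Local Open Scope ring_scope.

Reserved Notation "x ⊗ y" (at level 38, left associativity).


Section Presentation.
Variables (A : comNzRingType) (G : Type).

Inductive aterm : Type :=
  | Gen of G
  | Scal of A
  | Add of aterm & aterm
  | Mul of aterm & aterm.

HB.instance Definition _ := Choice.copy aterm {classic aterm}.

Variable rel : aterm -> aterm -> Prop.

(* The least congruence containing [rel] for which the quotient is a unital
   associative [A]-algebra; the opposite of [x] is [Mul (Scal (-1)) x]. *)
Inductive acong : aterm -> aterm -> Prop :=
  | acong_rel x y : rel x y -> acong x y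
  | acong_refl x : acong x x
  | acong_sym x y : acong x y -> acong y x
  | acong_trans y x z : acong x y -> acong y z -> acong x z
  | acong_add x x' y y' :
      acong x x' -> acong y y' -> acong (Add x y) (Add x' y')
  | acong_mul x x' y y' :
      acong x x' -> acong y y' -> acong (Mul x y) (Mul x' y')
  | acong_addA x y z : acong (Add x (Add y z)) (Add (Add x y) z)
  | acong_addC x y : acong (Add x y) (Add y x)
  | acong_add0 x : acong (Add (Scal 0) x) x
  | acong_addN x : acong (Add (Mul (Scal (-1)) x) x) (Scal 0)
  | acong_mulA x y z : acong (Mul x (Mul y z)) (Mul (Mul x y) z)
  | acong_mul1l x : acong (Mul (Scal 1) x) x
  | acong_mul1r x : acong (Mul x (Scal 1)) x
  | acong_mulDl x y z : acong (Mul (Add x y) z) (Add (Mul x z) (Mul y z))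
  | acong_mulDr x y z : acong (Mul x (Add y z)) (Add (Mul x y) (Mul x z))
  | acong_scalD a b : acong (Scal (a + b)) (Add (Scal a) (Scal b))
  | acong_scalM a b : acong (Scal (a * b)) (Mul (Scal a) (Scal b))
  | acong_scalC a x : acong (Mul (Scal a) x) (Mul x (Scal a)).

Definition acongb (x y : aterm) : bool := `[< acong x y >].

Lemma acongb_refl : reflexive acongb.
Proof. by move=> x; apply/asboolP/acong_refl. Qed.
Lemma acongb_sym : symmetric acongb.
Proof.
by move=> x y; apply/idP/idP => /asboolP h; apply/asboolP/acong_sym.
Qed.
Lemma acongb_trans : transitive acongb.
Proof.
by move=> y x z /asboolP h1 /asboolP h2; apply/asboolP/(acong_trans h1 h2).
Qed.

Canonical acong_equiv := EquivRel acongb acongb_refl acongb_sym acongb_trans.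

Definition palg : Type := {eq_quot acong_equiv}.
HB.instance Definition _ := Choice.on palg.

Definition cls (x : aterm) : palg := \pi_({eq_quot acong_equiv}) x.
Definition rpr (u : palg) : aterm := repr (u : {eq_quot acong_equiv}).

Lemma cls_rpr u : cls (rpr u) = u.
Proof. exact: reprK. Qed.
Lemma cls_eq x y : acong x y -> cls x = cls y.
Proof. by move=> h; apply/eqmodP/asboolP. Qed.
Lemma rpr_cls x : acong (rpr (cls x)) x.
Proof.
suff: acong_equiv (rpr (cls x)) x by move/asboolP.
exact/eqmodP/reprK.
Qed.

Definition palg_add u v := cls (Add (rpr u) (rpr v)).
Definition palg_opp u := cls (Mul (Scal (-1)) (rpr u)).
Definition palg_mul u v := cls (Mul (rpr u) (rpr v)).
Definition palg_scale a u := cls (Mul (Scal a) (rpr u)).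

Lemma cls_add x y : palg_add (cls x) (cls y) = cls (Add x y).
Proof. by apply: cls_eq; apply: acong_add; apply: rpr_cls. Qed.
Lemma cls_mul x y : palg_mul (cls x) (cls y) = cls (Mul x y).
Proof. by apply: cls_eq; apply: acong_mul; apply: rpr_cls. Qed.
Lemma cls_opp x : palg_opp (cls x) = cls (Mul (Scal (-1)) x).
Proof. by apply/cls_eq/acong_mul; [exact: acong_refl|exact: rpr_cls]. Qed.
Lemma cls_scale a x : palg_scale a (cls x) = cls (Mul (Scal a) x).
Proof. by apply/cls_eq/acong_mul; [exact: acong_refl|exact: rpr_cls]. Qed.

Lemma palg_ind (P : palg -> Prop) : (forall x, P (cls x)) -> forall u, P u.
Proof. by move=> h u; rewrite -[u]cls_rpr. Qed.

Let palgE := (cls_add, cls_mul, cls_opp, cls_scale).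

Fact palg_addA : associative palg_add.
Proof.
by elim/palg_ind=> x; elim/palg_ind=> y; elim/palg_ind=> z; rewrite !palgE;
   apply/cls_eq/acong_addA.
Qed.
Fact palg_addC : commutative palg_add.
Proof.
by elim/palg_ind=> x; elim/palg_ind=> y; rewrite !palgE;
   apply/cls_eq/acong_addC.
Qed.
Fact palg_add0 : left_id (cls (Scal 0)) palg_add.
Proof. by elim/palg_ind=> x; rewrite !palgE; apply/cls_eq/acong_add0. Qed.
Fact palg_addN : left_inverse (cls (Scal 0)) palg_opp palg_add.
Proof. by elim/palg_ind=> x; rewrite !palgE; apply/cls_eq/acong_addN. Qed.

HB.instance Definition _ := GRing.isZmodule.Build palg
  palg_addA palg_addC palg_add0 palg_addN.

Fact palg_mulA : associative palg_mul.
Proof.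
by elim/palg_ind=> x; elim/palg_ind=> y; elim/palg_ind=> z; rewrite !palgE;
   apply/cls_eq/acong_mulA.
Qed.
Fact palg_mul1l : left_id (cls (Scal 1)) palg_mul.
Proof. by elim/palg_ind=> x; rewrite !palgE; apply/cls_eq/acong_mul1l. Qed.
Fact palg_mul1r : right_id (cls (Scal 1)) palg_mul.
Proof. by elim/palg_ind=> x; rewrite !palgE; apply/cls_eq/acong_mul1r. Qed.
Fact palg_mulDl : left_distributive palg_mul +%R.
Proof.
by elim/palg_ind=> x; elim/palg_ind=> y; elim/palg_ind=> z;
   rewrite -![_ + _]/(palg_add _ _) !palgE; apply/cls_eq/acong_mulDl.
Qed.
Fact palg_mulDr : right_distributive palg_mul +%R.
Proof.
by elim/palg_ind=> x; elim/palg_ind=> y; elim/palg_ind=> z;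
   rewrite -![_ + _]/(palg_add _ _) !palgE; apply/cls_eq/acong_mulDr.
Qed.

HB.instance Definition _ := GRing.Zmodule_isPzRing.Build palg
  palg_mulA palg_mul1l palg_mul1r palg_mulDl palg_mulDr.

Lemma cls_mulE x y : cls x * cls y = cls (Mul x y). Proof. exact: cls_mul. Qed.
Lemma cls_addE x y : cls x + cls y = cls (Add x y). Proof. exact: cls_add. Qed.
Lemma palg_scaleE a u : palg_scale a u = cls (Scal a) * u.
Proof. by elim/palg_ind: u => x; rewrite cls_scale cls_mulE. Qed.
Lemma cls_scalD a b : cls (Scal (a + b)) = cls (Scal a) + cls (Scal b).
Proof. by rewrite cls_addE; apply/cls_eq/acong_scalD. Qed.
Lemma cls_scalM a b : cls (Scal (a * b)) = cls (Scal a) * cls (Scal b).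
Proof. by rewrite cls_mulE; apply/cls_eq/acong_scalM. Qed.
Lemma cls_scalC a u : cls (Scal a) * u = u * cls (Scal a).
Proof.
by elim/palg_ind: u => x; rewrite !cls_mulE; apply/cls_eq/acong_scalC.
Qed.

Fact palg_scaleA a b u : palg_scale a (palg_scale b u) = palg_scale (a * b) u.
Proof. by rewrite !palg_scaleE cls_scalM mulrA. Qed.
Fact palg_scale1 : left_id 1 palg_scale.
Proof. by move=> u; rewrite palg_scaleE mul1r. Qed.
Fact palg_scaleDr : right_distributive palg_scale +%R.
Proof. by move=> a u v; rewrite !palg_scaleE mulrDr. Qed.
Fact palg_scaleDl u : {morph palg_scale^~ u : a b / a + b}.
Proof. by move=> a b; rewrite !palg_scaleE cls_scalD mulrDl. Qed.

HB.instance Definition _ := GRing.Zmodule_isLmodule.Build A palg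
  palg_scaleA palg_scale1 palg_scaleDr palg_scaleDl.

Fact palg_scaleAl (a : A) (u v : palg) : a *: (u * v) = a *: u * v.
Proof. by rewrite -![_ *: _]/(palg_scale _ _) !palg_scaleE mulrA. Qed.
Fact palg_scaleAr (a : A) (u v : palg) : a *: (u * v) = u * (a *: v).
Proof.
by rewrite -![_ *: _]/(palg_scale _ _) !palg_scaleE mulrA cls_scalC mulrA.
Qed.

Lemma cls_scal a : cls (Scal a) = a *: (1 : palg).
Proof. by rewrite -[_ *: _]/(palg_scale _ _) palg_scaleE mulr1. Qed.

(* Scalars act on [B] through [phi]: this also covers semilinear morphisms. *)
Section Lift.
Variables (B : pzRingType) (phi : {rmorphism A -> B}) (v : G -> B).

Fixpoint aeval (x : aterm) : B :=
  match x with
  | Gen g => v g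
  | Scal a => phi a
  | Add x y => aeval x + aeval y
  | Mul x y => aeval x * aeval y
  end.

Definition palg_lift (u : palg) : B := aeval (rpr u).

Hypothesis phiC : forall a b, phi a * b = b * phi a.
Hypothesis relP : forall x y, rel x y -> aeval x = aeval y.

Lemma aeval_cong x y : acong x y -> aeval x = aeval y.
Proof.
elim=> //=.
- by move=> *; etransitivity; eassumption.
- by move=> ? ? ? ? _ -> _ ->.
- by move=> ? ? ? ? _ -> _ ->.
- by move=> *; rewrite addrA.
- by move=> *; rewrite addrC.
- by move=> *; rewrite rmorph0 add0r.
- by move=> *; rewrite rmorphN rmorph1 rmorph0 mulN1r addNr.
- by move=> *; rewrite mulrA.
- by move=> *; rewrite rmorph1 mul1r.
- by move=> *; rewrite rmorph1 mulr1.
- by move=> *; rewrite mulrDl.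
- by move=> *; rewrite mulrDr.
- by move=> *; rewrite rmorphD.
- by move=> *; rewrite rmorphM.
Qed.

Lemma palg_liftE x : palg_lift (cls x) = aeval x.
Proof. exact/aeval_cong/rpr_cls. Qed.

Lemma palg_lift_zmod : zmod_morphism palg_lift.
Proof.
elim/palg_ind=> x; elim/palg_ind=> y.
rewrite -[- _]/(palg_opp _) cls_opp cls_addE !palg_liftE /=.
by rewrite rmorphN rmorph1 mulN1r.
Qed.

Lemma palg_lift_monoid : monoid_morphism palg_lift.
Proof.
split; first by rewrite palg_liftE /= rmorph1.
by elim/palg_ind=> x; elim/palg_ind=> y; rewrite cls_mulE !palg_liftE.
Qed.

Lemma palg_liftZ a u : palg_lift (a *: u) = phi a * palg_lift u.
Proof.
elim/palg_ind: u => x.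
by rewrite -[_ *: _]/(palg_scale _ _) cls_scale !palg_liftE.
Qed.

End Lift.
End Presentation.

Arguments Scal {A G}.
Arguments Gen {A G}.
Arguments palg_lift {A G rel B} phi v u.


Section Tensor.
Variables (A : comNzRingType) (U V : algType A).

(* The formal sum of the [p.1 ⊗ p.2] for [p] in a list. *)
Definition fsum : Type := seq (U * V).

HB.instance Definition _ := Choice.on fsum.

Inductive tcong : fsum -> fsum -> Prop :=
  | tcong_refl s : tcong s s
  | tcong_sym s r : tcong s r -> tcong r s
  | tcong_trans r s q : tcong s r -> tcong r q -> tcong s q
  | tcong_cat s s' r r' : tcong s s' -> tcong r r' -> tcong (s ++ r) (s' ++ r')
  | tcong_catC s r : tcong (s ++ r) (r ++ s)
  | tcong_0 v : tcong [:: (0, v)] [::]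
  | tcong_addl u u' v : tcong [:: (u + u', v)] [:: (u, v); (u', v)]
  | tcong_addr u v v' : tcong [:: (u, v + v')] [:: (u, v); (u, v')]
  | tcong_scale a u v : tcong [:: (a *: u, v)] [:: (u, a *: v)].

Definition tcongb (s r : fsum) : bool := `[< tcong s r >].

Lemma tcongb_refl : reflexive tcongb.
Proof. by move=> x; apply/asboolP/tcong_refl. Qed.
Lemma tcongb_sym : symmetric tcongb.
Proof.
by move=> x y; apply/idP/idP => /asboolP h; apply/asboolP/tcong_sym.
Qed.
Lemma tcongb_trans : transitive tcongb.
Proof.
by move=> y x z /asboolP h1 /asboolP h2; apply/asboolP/(tcong_trans h1 h2).
Qed.

Canonical tcong_equiv := EquivRel tcongb tcongb_refl tcongb_sym tcongb_trans.

Definition tens : Type := {eq_quot tcong_equiv}.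
HB.instance Definition _ := Choice.on tens.

Definition tcls (s : fsum) : tens := \pi_({eq_quot tcong_equiv}) s.
Definition trpr (x : tens) : fsum := repr (x : {eq_quot tcong_equiv}).

Lemma tcls_rpr x : tcls (trpr x) = x.
Proof. exact: reprK. Qed.
Lemma tcls_eq s r : tcong s r -> tcls s = tcls r.
Proof. by move=> h; apply/eqmodP/asboolP. Qed.
Lemma trpr_cls s : tcong (trpr (tcls s)) s.
Proof.
suff: tcong_equiv (trpr (tcls s)) s by move/asboolP.
exact/eqmodP/reprK.
Qed.
Lemma tens_cls_ind (P : tens -> Prop) :
  (forall s, P (tcls s)) -> forall x, P x.
Proof. by move=> h x; rewrite -[x]tcls_rpr. Qed.

Definition fscale (a : A) (s : fsum) : fsum := [seq (a *: p.1, p.2) | p <- s].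
Definition fmul (s r : fsum) : fsum :=
  [seq (p.1 * q.1, p.2 * q.2) | p <- s, q <- r].

Lemma fscale_cong a s r : tcong s r -> tcong (fscale a s) (fscale a r).
Proof.
elim=> {s r} /=.
- by move=> s; apply: tcong_refl.
- by move=> s r _; apply: tcong_sym.
- by move=> s r q _ h1 _ h2; apply: tcong_trans h1 h2.
- by move=> s s' r r' _ h1 _ h2; rewrite /fscale !map_cat; apply: tcong_cat.
- by move=> s r; rewrite /fscale !map_cat; apply: tcong_catC.
- by move=> v; rewrite scaler0; apply: tcong_0.
- by move=> u u' v; rewrite scalerDr; apply: tcong_addl.
- by move=> u v v'; apply: tcong_addr.
- by move=> b u v; rewrite scalerA mulrC -scalerA; apply: tcong_scale.
Qed.

Lemma fmul_catl s s' r : fmul (s ++ s') r = fmul s r ++ fmul s' r.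
Proof. by rewrite /fmul allpairs_cat. Qed.

Lemma fmul_cons p s r :
  fmul (p :: s) r = [seq (p.1 * q.1, p.2 * q.2) | q <- r] ++ fmul s r.
Proof. by []. Qed.

Lemma fmul_catr s r r' : tcong (fmul s (r ++ r')) (fmul s r ++ fmul s r').
Proof.
elim: s => [|p s IH]; first exact: tcong_refl.
rewrite -cat1s !fmul_catl; apply: tcong_trans.
  apply: tcong_cat IH; rewrite /fmul /= cats0 map_cat; exact: tcong_refl.
rewrite /fmul /= !cats0 -!catA; apply: tcong_cat; first exact: tcong_refl.
rewrite !catA; apply: tcong_cat; [exact: tcong_catC | exact: tcong_refl].
Qed.

Lemma tcong_mid p q s r : tcong ([:: p; q] ++ (s ++ r)) ((p :: s) ++ (q :: r)).
Proof.
rewrite -(cat1s p s) -(cat1s q r) -(cat1s p [:: q]) -!catA.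
apply: tcong_cat; first exact: tcong_refl.
by rewrite !catA; apply: tcong_cat; [exact: tcong_catC | exact: tcong_refl].
Qed.

Lemma fmul_congl s s' r : tcong s s' -> tcong (fmul s r) (fmul s' r).
Proof.
elim=> {s s'}.
- by move=> s; apply: tcong_refl.
- by move=> s s' _; apply: tcong_sym.
- by move=> s q p _ h1 _ h2; apply: tcong_trans h1 h2.
- by move=> s s' q q' _ h1 _ h2; rewrite !fmul_catl; apply: tcong_cat.
- by move=> s q; rewrite !fmul_catl; apply: tcong_catC.
- move=> v; rewrite /fmul /= cats0.
  elim: r => [|p r IH] /=; first exact: tcong_refl.
  by rewrite mul0r; apply: (@tcong_cat [:: _] [::] _ [::]) IH; apply: tcong_0.
- move=> u u' v; rewrite /fmul /= !cats0.
  elim: r => [|p r IH] /=; first exact: tcong_refl.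
  rewrite mulrDl.
  apply: tcong_trans; first by apply: (@tcong_cat [:: _]) IH; exact: tcong_addl.
  exact: tcong_mid.
- move=> u v v'; rewrite /fmul /= !cats0.
  elim: r => [|p r IH] /=; first exact: tcong_refl.
  rewrite mulrDl.
  apply: tcong_trans; first by apply: (@tcong_cat [:: _]) IH; exact: tcong_addr.
  exact: tcong_mid.
- move=> a u v; rewrite /fmul /= !cats0.
  elim: r => [|p r IH] /=; first exact: tcong_refl.
  by rewrite -!scalerAl; apply: (@tcong_cat [:: _] [:: _]) IH; apply: tcong_scale.
Qed.

Lemma fmul_congr s r r' : tcong r r' -> tcong (fmul s r) (fmul s r').
Proof.
elim=> {r r'}.
- by move=> r; apply: tcong_refl.
- by move=> r r' _; apply: tcong_sym.
- by move=> r q p _ h1 _ h2; apply: tcong_trans h1 h2.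
- move=> r r' q q' _ h1 _ h2.
  apply: tcong_trans (fmul_catr _ _ _) _.
  apply: tcong_trans (tcong_sym (fmul_catr _ _ _)).
  exact: tcong_cat.
- move=> r q; apply: tcong_trans (fmul_catr _ _ _) _.
  apply: tcong_trans (tcong_sym (fmul_catr _ _ _)).
  exact: tcong_catC.
- move=> v; elim: s => [|p s IH]; first exact: tcong_refl.
  rewrite !fmul_cons /=.
  by rewrite mulr0; apply: (@tcong_cat [:: _] [::]) IH; apply: tcong_0.
- move=> u u' v; elim: s => [|p s IH]; first exact: tcong_refl.
  rewrite !fmul_cons /=.
  by rewrite mulrDr; apply: (@tcong_cat [:: _] [:: _; _]) IH; apply: tcong_addl.
- move=> u v v'; elim: s => [|p s IH]; first exact: tcong_refl.
  rewrite !fmul_cons /=.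
  by rewrite mulrDr; apply: (@tcong_cat [:: _] [:: _; _]) IH; apply: tcong_addr.
- move=> a u v; elim: s => [|p s IH]; first exact: tcong_refl.
  rewrite !fmul_cons /=.
  by rewrite -!scalerAr; apply: (@tcong_cat [:: _] [:: _]) IH; apply: tcong_scale.
Qed.

Definition tens_add x y := tcls (trpr x ++ trpr y).
Definition tens_scale a x := tcls (fscale a (trpr x)).
Definition tens_mul x y := tcls (fmul (trpr x) (trpr y)).

Lemma tcls_add s r : tens_add (tcls s) (tcls r) = tcls (s ++ r).
Proof. by apply/tcls_eq/tcong_cat; apply: trpr_cls. Qed.
Lemma tcls_scale a s : tens_scale a (tcls s) = tcls (fscale a s).
Proof. by apply/tcls_eq/fscale_cong/trpr_cls. Qed.
Lemma tcls_mul s r : tens_mul (tcls s) (tcls r) = tcls (fmul s r).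
Proof.
apply/tcls_eq/(@tcong_trans (fmul s (trpr (tcls r)))).
  exact/fmul_congl/trpr_cls.
exact/fmul_congr/trpr_cls.
Qed.

Let tensE := (tcls_add, tcls_scale, tcls_mul).

Fact tens_addA : associative tens_add.
Proof.
by elim/tens_cls_ind=> x; elim/tens_cls_ind=> y; elim/tens_cls_ind=> z;
   rewrite !tensE catA.
Qed.
Fact tens_addC : commutative tens_add.
Proof.
by elim/tens_cls_ind=> x; elim/tens_cls_ind=> y; rewrite !tensE;
   apply/tcls_eq/tcong_catC.
Qed.
Fact tens_add0 : left_id (tcls [::]) tens_add.
Proof. by elim/tens_cls_ind=> x; rewrite tensE. Qed.
Fact tens_addN : left_inverse (tcls [::]) (tens_scale (-1)) tens_add.
Proof.
elim/tens_cls_ind=> s; rewrite !tensE; apply: tcls_eq.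
elim: s => [|[u v] s IH] /=; first exact: tcong_refl.
apply: tcong_trans (tcong_sym (tcong_mid (-1 *: u, v) (u, v) _ _)) _.
apply: (@tcong_cat [:: _; _] [::] _ [::]) IH.
apply: tcong_trans (tcong_sym (tcong_addl _ _ _)) _.
by rewrite scaleN1r addNr; apply: tcong_0.
Qed.

HB.instance Definition _ := GRing.isZmodule.Build tens
  tens_addA tens_addC tens_add0 tens_addN.

Lemma tcls_addE s r : tcls s + tcls r = tcls (s ++ r).
Proof. exact: tcls_add. Qed.

Definition ptens (u : U) (v : V) : tens := tcls [:: (u, v)].
Local Notation "u ⊗ v" := (ptens u v).

Lemma tcls_cons p s : tcls (p :: s) = p.1 ⊗ p.2 + tcls s.
Proof. by rewrite tcls_addE /= -surjective_pairing. Qed.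
Lemma tcls_sum s : tcls s = \sum_(p <- s) p.1 ⊗ p.2.
Proof.
elim: s => [|p s IH]; first by rewrite big_nil.
by rewrite tcls_cons big_cons IH.
Qed.

Lemma tens_ind (P : tens -> Prop) :
  P 0 -> (forall u v x, P x -> P (u ⊗ v + x)) -> forall x, P x.
Proof.
by move=> P0 PD; elim/tens_cls_ind; elim=> [|p s IH] //; rewrite tcls_cons; apply: PD.
Qed.

Lemma ptensDl u u' v : (u + u') ⊗ v = u ⊗ v + u' ⊗ v.
Proof. by rewrite tcls_addE; apply/tcls_eq/tcong_addl. Qed.
Lemma ptensDr u v v' : u ⊗ (v + v') = u ⊗ v + u ⊗ v'.
Proof. by rewrite tcls_addE; apply/tcls_eq/tcong_addr. Qed.

Fact tens_scaleA a b x : tens_scale a (tens_scale b x) = tens_scale (a * b) x.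
Proof.
elim/tens_cls_ind: x => s; rewrite !tensE /fscale -map_comp.
by congr tcls; apply: eq_map => p /=; rewrite scalerA.
Qed.
Fact tens_scale1 : left_id 1 tens_scale.
Proof.
elim/tens_cls_ind => s; rewrite !tensE /fscale; congr tcls.
by rewrite -[RHS]map_id; apply: eq_map => -[u v] /=; rewrite scale1r.
Qed.
Fact tens_scaleDr : right_distributive tens_scale +%R.
Proof.
move=> a; elim/tens_cls_ind=> s; elim/tens_cls_ind=> r.
by rewrite tcls_addE !tensE tcls_addE /fscale map_cat.
Qed.
Fact tens_scale_ptens a u v : tens_scale a (u ⊗ v) = (a *: u) ⊗ v.
Proof. exact: (tcls_scale a [:: (u, v)]). Qed.
Fact tens_scaleDl x : {morph tens_scale^~ x : a b / a + b}.
Proof.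
have scale0 c : tens_scale c 0 = 0 by exact: (tcls_scale c [::]).
move=> a b; elim/tens_ind: x => [|u v x IH]; first by rewrite /= !scale0 addr0.
by rewrite /= !tens_scaleDr IH !tens_scale_ptens scalerDl ptensDl addrACA.
Qed.

HB.instance Definition _ := GRing.Zmodule_isLmodule.Build A tens
  tens_scaleA tens_scale1 tens_scaleDr tens_scaleDl.

Lemma ptensZl a u v : (a *: u) ⊗ v = a *: (u ⊗ v).
Proof. by rewrite -[_ *: (_ ⊗ _)]/(tens_scale _ _) tens_scale_ptens. Qed.
Lemma ptensZr a u v : u ⊗ (a *: v) = a *: (u ⊗ v).
Proof. by rewrite -ptensZl; apply/tcls_eq/tcong_sym/tcong_scale. Qed.

Lemma ptens0l v : 0 ⊗ v = 0.
Proof. exact/tcls_eq/tcong_0. Qed.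
Lemma ptens0r u : u ⊗ 0 = 0.
Proof. by rewrite -(scale0r 0) ptensZr -ptensZl scale0r ptens0l. Qed.
Lemma ptensBl u u' v : (u - u') ⊗ v = u ⊗ v - u' ⊗ v.
Proof. by rewrite -scaleN1r ptensDl ptensZl scaleN1r. Qed.
Lemma ptensBr u v v' : u ⊗ (v - v') = u ⊗ v - u ⊗ v'.
Proof. by rewrite -scaleN1r ptensDr ptensZr scaleN1r. Qed.

Fact tens_mulDl : left_distributive tens_mul +%R.
Proof.
elim/tens_cls_ind=> s; elim/tens_cls_ind=> r; elim/tens_cls_ind=> q.
by rewrite tcls_addE !tensE tcls_addE fmul_catl.
Qed.
Fact tens_mulDr : right_distributive tens_mul +%R.
Proof.
elim/tens_cls_ind=> s; elim/tens_cls_ind=> r; elim/tens_cls_ind=> q.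
by rewrite tcls_addE !tensE tcls_addE; apply/tcls_eq/fmul_catr.
Qed.
Fact tens_mul_ptens u v u' v' : tens_mul (u ⊗ v) (u' ⊗ v') = (u * u') ⊗ (v * v').
Proof. exact: (tcls_mul [:: (u, v)] [:: (u', v')]). Qed.
Fact tens_mul0l x : tens_mul 0 x = 0.
Proof. by apply: (@addIr _ (tens_mul 0 x)); rewrite -tens_mulDl !add0r. Qed.
Fact tens_mul0r x : tens_mul x 0 = 0.
Proof. by apply: (@addIr _ (tens_mul x 0)); rewrite -tens_mulDr !add0r. Qed.
Fact tens_mul1l : left_id (1 ⊗ 1) tens_mul.
Proof.
elim/tens_ind=> [|u v x IH]; first by rewrite tens_mul0r.
by rewrite tens_mulDr IH tens_mul_ptens !mul1r.
Qed.
Fact tens_mul1r : right_id (1 ⊗ 1) tens_mul.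
Proof.
elim/tens_ind=> [|u v x IH]; first by rewrite tens_mul0l.
by rewrite tens_mulDl IH tens_mul_ptens !mulr1.
Qed.
Fact tens_mulA : associative tens_mul.
Proof.
elim/tens_ind=> [|u v x IH] y z; first by rewrite !tens_mul0l.
rewrite !tens_mulDl IH; congr (_ + _) => {x IH}.
elim/tens_ind: y => [|u1 v1 y IH]; first by rewrite !(tens_mul0l, tens_mul0r).
rewrite !(tens_mulDl, tens_mulDr) IH; congr (_ + _) => {y IH}.
elim/tens_ind: z => [|u2 v2 z IH]; first by rewrite !(tens_mul0l, tens_mul0r).
by rewrite !(tens_mulDl, tens_mulDr) IH !tens_mul_ptens !mulrA.
Qed.

HB.instance Definition _ := GRing.Zmodule_isPzRing.Build tens
  tens_mulA tens_mul1l tens_mul1r tens_mulDl tens_mulDr.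

Lemma ptensM u v u' v' : (u ⊗ v) * (u' ⊗ v') = (u * u') ⊗ (v * v').
Proof. exact: tens_mul_ptens. Qed.

Fact tens_scaleAl (a : A) (x y : tens) : a *: (x * y) = a *: x * y.
Proof.
elim/tens_ind: x => [|u v x IH]; first by rewrite mul0r scaler0 mul0r.
rewrite !(mulrDl, scalerDr) IH; congr (_ + _) => {x IH}.
elim/tens_ind: y => [|u1 v1 y IH]; first by rewrite !mulr0 scaler0.
by rewrite !(mulrDr, scalerDr) IH -ptensZl !ptensM -ptensZl scalerAl.
Qed.
Fact tens_scaleAr (a : A) (x y : tens) : a *: (x * y) = x * (a *: y).
Proof.
elim/tens_ind: x => [|u v x IH]; first by rewrite !mul0r scaler0.
rewrite !(mulrDl, scalerDr) IH; congr (_ + _) => {x IH}.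
elim/tens_ind: y => [|u1 v1 y IH]; first by rewrite !(mulr0, scaler0).
by rewrite !(mulrDr, scalerDr) IH -!ptensZl !ptensM -ptensZl scalerAr.
Qed.

(* Used only to see that [1 != 0] in a tensor product of augmented algebras. *)
Section Lift.
Variables (f : {lrmorphism U -> A^o}) (g : {lrmorphism V -> A^o}).

Definition tens_lift (x : tens) : A := \sum_(p <- trpr x) f p.1 * g p.2.

Lemma tens_lift_cls s : tens_lift (tcls s) = \sum_(p <- s) f p.1 * g p.2.
Proof.
rewrite /tens_lift; move: (trpr _) (trpr_cls s) => r; elim=> {r s} //.
- by move=> ? ? ? _ -> _ ->.
- by move=> ? ? ? ? _ h1 _ h2; rewrite !big_cat /= h1 h2.
- by move=> ? ?; rewrite !big_cat /= addrC.
- by move=> ?; rewrite big_nil big_cons big_nil addr0 /= rmorph0 mul0r.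
- by move=> u u' v; rewrite !big_cons !big_nil !addr0 /= rmorphD mulrDl.
- by move=> u v v'; rewrite !big_cons !big_nil !addr0 /= rmorphD mulrDr.
- by move=> a u v; rewrite !big_cons !big_nil !addr0 /= !linearZ /= mulrCA -mulrA.
Qed.

Lemma tens_oner_neq0 : (1 : tens) != 0.
Proof.
apply/eqP => /(congr1 tens_lift); apply/eqP.
rewrite -[1]/(tcls _) -[0]/(tcls _) !tens_lift_cls big_nil big_cons big_nil addr0 /=.
by rewrite !rmorph1 mulr1 oner_neq0.
Qed.
End Lift.

End Tensor.

Notation "u ⊗ v" := (ptens u v) : ring_scope.


Inductive sl2 : Type := Ep | Em | H0.

Definition sl2_enc (a : sl2) : option bool :=
  match a with Ep => Some true | Em => Some false | H0 => None end.
Definition sl2_dec (o : option bool) : sl2 :=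
  match o with Some true => Ep | Some false => Em | None => H0 end.
Lemma sl2_encK : cancel sl2_enc sl2_dec. Proof. by case. Qed.
HB.instance Definition _ := Finite.copy sl2 (can_type sl2_encK).

(* [sl2_br a b = (n, c)] stands for the bracket [a, b] = n c. *)
Definition sl2_br (a b : sl2) : int * sl2 :=
  match a, b with
  | H0, Ep => (2, Ep)
  | Ep, H0 => (-2, Ep)
  | H0, Em => (-2, Em)
  | Em, H0 => (2, Em)
  | Ep, Em => (1, H0)
  | Em, Ep => (-1, H0)
  | _, _ => (0, a)
  end.

Lemma big_sl2 (V : zmodType) (F : sl2 -> V) :
  \sum_(a : sl2) F a = F Ep + F Em + F H0.
Proof.
rewrite (bigD1 Ep) //= (bigD1 Em) //= (bigD1 H0) //= big_pred0; last by case.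
by rewrite addr0 addrA.
Qed.

Section Sl2Tensors.
Variable K : numFieldType.

(* f^{ab}_c *)
Definition sl2_sc (a b c : sl2) : K :=
  if (sl2_br a b).2 == c then (sl2_br a b).1%:~R else 0.

(* The invariant form is the trace form of the two-dimensional representation,
   (E^+, E^-) = 1 and (H, H) = 2; [sl2_kappa] is the inverse matrix, which
   lowers indices. This normalization is the one for which the coproduct of
   the Yangian below reads
   Δ(ĵ^a) = ĵ^a ⊗ 1 + 1 ⊗ ĵ^a + α/2 f^a_{bc} j^b ⊗ j^c. *)
Definition sl2_kappa (a b : sl2) : K :=
  match a, b with
  | Ep, Em | Em, Ep => 1
  | H0, H0 => 2^-1
  | _, _ => 0
  end.

(* f^a_{bc} *)
Definition sl2_f (a b c : sl2) : K := \sum_d sl2_kappa b d * sl2_sc a d c.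

Lemma sl2_fE (a b c : sl2) : sl2_f a b c =
  match a, b, c with
  | Ep, Ep, H0 | Em, H0, Em => 1
  | Ep, H0, Ep | Em, Em, H0 => -1
  | H0, Ep, Em => -2
  | H0, Em, Ep => 2
  | _, _, _ => 0
  end.
Proof.
by rewrite /sl2_f big_sl2; case: a; case: b; case: c; rewrite /sl2_kappa /sl2_sc /=;
   field.
Qed.

(* The eigenvalue of κ_{bc} j^b j^c in the adjoint representation. *)
Definition sl2_cg : K := 4.

Lemma sl2_casimir (a e : sl2) :
  \sum_b \sum_c \sum_d sl2_kappa b c * (sl2_sc c a d * sl2_sc b d e) =
  sl2_cg * (a == e)%:R.
Proof.
by rewrite !big_sl2 /sl2_cg; case: a; case: e; rewrite /sl2_kappa /sl2_sc /=; field.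
Qed.

End Sl2Tensors.


Inductive Ygen : Type := Lv0 of sl2 | Lv1 of sl2.


(* Reflexive normalization, used only to check that the coproduct is well
   defined. The letter [(r, l, a)] is the generator of level [l] and index [a]
   in the left ([r = false]) or right tensor factor; a monomial [(c, n, w)] is
   c (α/2)^n w. *)
Section Straightening.

Definition letter : Type := (bool * bool * sl2)%type.
Definition ncpoly : Type := seq (int * nat * seq letter).

Definition sl2_rank (a : sl2) : nat :=
  match a with Em => 0 | H0 => 1 | Ep => 2 end.

Definition rule (x y : letter) : option (int * letter) :=
  let: (rx, lx, a) := x in
  let: (ry, ly, b) := y in
  match rx, ry with
  | true, false => Some (0, x)
  | false, true => None
  | _, _ =>
    if lx then None else
    if ly || (sl2_rank b < sl2_rank a)%N
    then Some ((sl2_br a b).1, (rx, ly, (sl2_br a b).2)) else None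
  end.

Definition pscale (c : int) (n : nat) (p : ncpoly) : ncpoly :=
  [seq (c * m.1.1, (n + m.1.2)%N, m.2) | m <- p].
Definition pmul (p q : ncpoly) : ncpoly :=
  [seq (m.1.1 * m'.1.1, (m.1.2 + m'.1.2)%N, m.2 ++ m'.2) | m <- p, m' <- q].
Definition psub (p q : ncpoly) : ncpoly := p ++ pscale (-1) 0 q.
Definition pcom (p q : ncpoly) : ncpoly := psub (pmul p q) (pmul q p).

Fixpoint ins (x : letter) (w : seq letter) : ncpoly :=
  match w with
  | [::] => [:: (1, 0%N, [:: x])]
  | y :: w' =>
    match rule x y with
    | None => [:: (1, 0%N, x :: w)]
    | Some (n, z) =>
      [seq (m.1, y :: m.2) | m <- ins x w'] ++ pscale n 0 (ins z w')
    end
  end.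

Definition psubst (g : seq letter -> ncpoly) (p : ncpoly) : ncpoly :=
  flatten [seq pscale m.1.1 m.1.2 (g m.2) | m <- p].

Fixpoint nfw (w : seq letter) : ncpoly :=
  if w is x :: w' then psubst (ins x) (nfw w') else [:: (1, 0%N, [::])].

Fixpoint collect1 (m : int * nat * seq letter) (p : ncpoly) : ncpoly :=
  if p is m' :: p' then
    if (m.1.2 == m'.1.2) && (m.2 == m'.2)
    then (m.1.1 + m'.1.1, m'.1.2, m'.2) :: p' else m' :: collect1 m p'
  else [:: m].

Definition pzero (p : ncpoly) : bool :=
  all (fun m => m.1.1 == 0) (foldr collect1 [::] (psubst nfw p)).

Variables (T : pzRingType) (beta : T) (e : letter -> T).

Definition wev (w : seq letter) : T := foldr (fun x t => e x * t) 1 w.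
Definition mev (m : int * nat * seq letter) : T :=
  (beta ^+ m.1.2 * wev m.2) *~ m.1.1.
Definition pev (p : ncpoly) : T := \sum_(m <- p) mev m.

Hypothesis betaC : forall x, beta * x = x * beta.
Hypothesis ruleP : forall x y n z,
  rule x y = Some (n, z) -> e x * e y = e y * e x + e z *~ n.

Lemma betaXC n x : beta ^+ n * x = x * beta ^+ n.
Proof.
elim: n => [|n IH]; first by rewrite expr0 mul1r mulr1.
by rewrite exprS -mulrA IH mulrA betaC -mulrA.
Qed.

Lemma pev_nil : pev [::] = 0. Proof. exact: big_nil. Qed.
Lemma pev_cons m p : pev (m :: p) = mev m + pev p. Proof. exact: big_cons. Qed.
Lemma pev_cat p q : pev (p ++ q) = pev p + pev q. Proof. exact: big_cat. Qed.

Lemma pev_scale c n p : pev (pscale c n p) = (beta ^+ n * pev p) *~ c.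
Proof.
elim: p => [|m p IH]; first by rewrite !pev_nil mulr0 mul0rz.
rewrite /= !pev_cons IH mulrDr mulrzDl; congr (_ + _).
by rewrite /mev /= exprD -mulrA mulrzAr -mulrzA mulrC.
Qed.

Lemma pev_sub p q : pev (psub p q) = pev p - pev q.
Proof. by rewrite pev_cat pev_scale expr0 mul1r mulrN1z. Qed.

Lemma wev_cat w w' : wev (w ++ w') = wev w * wev w'.
Proof. by elim: w => [|x w IH] /=; rewrite ?mul1r // IH mulrA. Qed.

Lemma pev_mul p q : pev (pmul p q) = pev p * pev q.
Proof.
elim: p => [|m p IH]; first by rewrite !pev_nil mul0r.
rewrite /pmul /= pev_cat -/(pmul p q) IH pev_cons mulrDl; congr (_ + _).
elim: q {IH} => [|m' q IH] /=; first by rewrite !pev_nil mulr0.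
rewrite !pev_cons mulrDr IH; congr (_ + _).
rewrite /mev /= wev_cat exprD mulrzAl mulrzAr -mulrzA [m'.1.1 * _]mulrC.
by congr (_ *~ _); rewrite -!mulrA; congr (_ * _); rewrite !mulrA betaXC.
Qed.

Lemma pev_com p q : pev (pcom p q) = pev p * pev q - pev q * pev p.
Proof. by rewrite pev_sub !pev_mul. Qed.

Lemma pev_ins x w : pev (ins x w) = e x * wev w.
Proof.
elim: w x => [|y w IH] x /=.
  by rewrite pev_cons pev_nil addr0 /mev /= expr0 mul1r mulr1z.
case E: (rule x y) => [[n z]|]; last first.
  by rewrite pev_cons pev_nil addr0 /mev /= expr0 mul1r mulr1z.
rewrite pev_cat pev_scale expr0 mul1r IH mulrA (ruleP E) mulrDl mulrzAl.
congr (_ + _); rewrite -mulrA -IH.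
elim: (ins x w) => [|m p IHp] /=; first by rewrite !pev_nil mulr0.
rewrite !pev_cons mulrDr IHp; congr (_ + _).
by rewrite /mev /= mulrzAr; congr (_ *~ _); rewrite mulrA betaXC mulrA.
Qed.

Lemma pev_subst g (h : seq letter -> T) p : (forall w, pev (g w) = h w) ->
  pev (psubst g p) = \sum_(m <- p) (beta ^+ m.1.2 * h m.2) *~ m.1.1.
Proof.
move=> gh; elim: p => [|m p IH]; first by rewrite big_nil pev_nil.
by rewrite big_cons /psubst /= pev_cat IH pev_scale gh.
Qed.

Lemma pev_nfw w : pev (nfw w) = wev w.
Proof.
elim: w => [|x w IH] /=.
  by rewrite pev_cons pev_nil addr0 /mev /= expr0 mul1r mulr1z.
rewrite (pev_subst _ (pev_ins x)) -IH /pev big_distrr /=.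
apply: eq_bigr => m _; rewrite /mev mulrzAr; congr (_ *~ _).
by rewrite mulrA betaXC mulrA.
Qed.

Lemma pev_collect1 m p : pev (collect1 m p) = mev m + pev p.
Proof.
elim: p => [|m' p IH] /=; first by rewrite pev_cons.
case: ifP => [/andP[/eqP h1 /eqP h2]|_]; last by rewrite !pev_cons IH addrCA.
by rewrite !pev_cons addrA; congr (_ + _); rewrite /mev /= h1 h2 mulrzDr.
Qed.

Lemma pzeroP p : pzero p -> pev p = 0.
Proof.
move=> h; transitivity (pev (foldr collect1 [::] (psubst nfw p))).
  transitivity (pev (psubst nfw p)); first by rewrite (pev_subst _ pev_nfw).
  by elim: (psubst nfw p) => //= m q IH; rewrite pev_collect1 pev_cons IH.
move: h; rewrite /pzero; elim: (foldr _ _ _) => [|m q IH] /=.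
  by rewrite pev_nil.
by case/andP=> /eqP h /IH; rewrite pev_cons /mev h mulr0z add0r.
Qed.

End Straightening.

Section Yangian.
Variable K : numFieldType.

Local Notation A := {poly K}.
Local Notation term := (aterm A Ygen).

Definition tsub (x y : term) : term := Add x (Mul (Scal (-1)) y).
Definition tcom (x y : term) : term := tsub (Mul x y) (Mul y x).

(* The formal parameter α is the indeterminate of [{poly K}]. *)
Definition alpha : A := 'X.

Local Notation j a := (Gen (Lv0 a)).
Local Notation ĵ a := (Gen (Lv1 a)).

(* The last relation generates, under the adjoint action of sl(2), the five
   relations of Drinfeld; its coefficient is the one imposed by the coproduct,
   see [coproduct_rel]. *)
Inductive Yrel : term -> term -> Prop :=
  | Yrel00 a b : Yrel (tcom (j a) (j b))
      (Mul (Scal (sl2_br a b).1%:~R) (j (sl2_br a b).2))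
  | Yrel01 a b : Yrel (tcom (j a) (ĵ b))
      (Mul (Scal (sl2_br a b).1%:~R) (ĵ (sl2_br a b).2))
  | Yrel_serre : Yrel (tcom (ĵ H0) (tcom (ĵ Ep) (ĵ Em)))
      (Mul (Scal (alpha ^+ 2))
        (Mul (tsub (Mul (ĵ Em) (j Ep)) (Mul (j Em) (ĵ Ep))) (j H0))).

Definition Y : Type := palg Yrel.
HB.instance Definition _ := GRing.Lmodule.on Y.
HB.instance Definition _ := GRing.PzRing.on Y.

Lemma aeval_tsub (B : pzRingType) (phi : {rmorphism A -> B}) v x y :
  aeval phi v (tsub x y) = aeval phi v x - aeval phi v y.
Proof. by rewrite /= rmorphN rmorph1 mulN1r. Qed.

Lemma aeval_tcom (B : pzRingType) (phi : {rmorphism A -> B}) v x y :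
  aeval phi v (tcom x y) =
  aeval phi v x * aeval phi v y - aeval phi v y * aeval phi v x.
Proof. exact: aeval_tsub. Qed.

Fact counit_rel x y : Yrel x y ->
  aeval idfun (fun=> 0) x = aeval idfun (fun=> 0) y :> A.
Proof. by case=> [a b|a b|]; rewrite /= ?(mul0r, mulr0, addr0). Qed.

Definition counit : Y -> A := palg_lift idfun (fun=> 0).

Fact counitC (a b : A) : idfun a * b = b * idfun a. Proof. exact: mulrC. Qed.

Fact Y_oner_neq0 : (1 : Y) != 0.
Proof.
apply/eqP => /(congr1 counit).
rewrite /counit !(palg_liftE counitC counit_rel) /= => /eqP.
by rewrite oner_eq0.
Qed.

HB.instance Definition _ := GRing.PzSemiRing_isNonZero.Build Y Y_oner_neq0.
HB.instance Definition _ := GRing.Lmodule_isLalgebra.Build A Y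
  (@palg_scaleAl _ _ (@Yrel)).
HB.instance Definition _ := GRing.Lalgebra_isAlgebra.Build A Y
  (@palg_scaleAr _ _ (@Yrel)).

HB.instance Definition _ := GRing.isZmodMorphism.Build Y A^o counit
  (palg_lift_zmod counitC counit_rel).
HB.instance Definition _ := GRing.isMonoidMorphism.Build Y A^o counit
  (palg_lift_monoid counitC counit_rel).
HB.instance Definition _ := GRing.isScalable.Build A Y A^o *:%R counit
  (palg_liftZ counitC counit_rel).

Definition YY : Type := tens Y Y.
HB.instance Definition _ := GRing.Lmodule.on YY.
HB.instance Definition _ := GRing.PzRing.on YY.
HB.instance Definition _ := GRing.PzSemiRing_isNonZero.Build YY
  (tens_oner_neq0 counit counit).
HB.instance Definition _ := GRing.Lmodule_isLalgebra.Build A YY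
  (@tens_scaleAl _ Y Y).
HB.instance Definition _ := GRing.Lalgebra_isAlgebra.Build A YY
  (@tens_scaleAr _ Y Y).


Definition Jgen (g : Ygen) : Y := cls _ (Gen g).
Definition J (a : sl2) : Y := Jgen (Lv0 a).
Definition Jh (a : sl2) : Y := Jgen (Lv1 a).

Lemma clsE (x : term) : cls _ x = aeval (in_alg Y) Jgen x :> Y.
Proof.
elim: x => //= [a|x <- y <-|x <- y <-]; last 2 first.
- by rewrite -cls_addE.
- by rewrite -cls_mulE.
by rewrite cls_scal.
Qed.

Lemma Yrel_aeval x y :
  Yrel x y -> aeval (in_alg Y) Jgen x = aeval (in_alg Y) Jgen y.
Proof. by move=> h; rewrite -!clsE; apply/cls_eq/acong_rel. Qed.

Lemma in_algC (B : algType A) (a : A) (b : B) : in_alg B a * b = b * in_alg B a.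
Proof. by rewrite /= mulr_algl mulr_algr. Qed.

Lemma J_comm a b :
  J a * J b - J b * J a = J (sl2_br a b).2 *~ (sl2_br a b).1.
Proof.
have /Yrel_aeval := Yrel00 a b.
by rewrite aeval_tcom /= => ->; rewrite scaler_int mulrzl.
Qed.

Lemma J_Jh_comm a b :
  J a * Jh b - Jh b * J a = Jh (sl2_br a b).2 *~ (sl2_br a b).1.
Proof.
have /Yrel_aeval := Yrel01 a b.
by rewrite aeval_tcom /= => ->; rewrite scaler_int mulrzl.
Qed.


Definition negX : {rmorphism A -> A} := comp_poly (- 'X).

Definition thetabar_gen (g : Ygen) : Y :=
  match g with Lv0 a => J a | Lv1 a => - Jh a end.


Lemma Jh_serre :
  Jh H0 * (Jh Ep * Jh Em - Jh Em * Jh Ep) -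
    (Jh Ep * Jh Em - Jh Em * Jh Ep) * Jh H0 =
  alpha ^+ 2 *: ((Jh Em * J Ep - J Em * Jh Ep) * J H0).
Proof.
have /Yrel_aeval := Yrel_serre.
by rewrite !(aeval_tcom, aeval_tsub) /= mulr_algl !scaleN1r !mulN1r.
Qed.

Fact thetabar_rel x y : Yrel x y ->
  aeval (in_alg Y \o negX) thetabar_gen x = aeval (in_alg Y \o negX) thetabar_gen y.
Proof.
case=> [a b|a b|].
- by rewrite aeval_tcom /= J_comm rmorph_int scaler_int mulrzl.
- rewrite aeval_tcom /= mulrN mulNr -opprD J_Jh_comm.
  by rewrite rmorph_int scaler_int mulrzl mulNrz.
- rewrite !aeval_tcom /= !rmorphN !rmorph1 !scaleN1r !mulN1r.
  rewrite rmorphXn /= comp_polyX sqrrN mulr_algl.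
  rewrite !mulrNN !mulNr !mulrN -!opprD Jh_serre.
  by rewrite mulNr scalerN.
Qed.

Fact thetabarC (a : A) (b : Y) : (in_alg Y \o negX) a * b = b * (in_alg Y \o negX) a.
Proof. exact: in_algC. Qed.

Definition thetabar : Y -> Y := palg_lift (in_alg Y \o negX) thetabar_gen.

HB.instance Definition _ := GRing.isZmodMorphism.Build Y Y thetabar
  (palg_lift_zmod thetabarC thetabar_rel).
HB.instance Definition _ := GRing.isMonoidMorphism.Build Y Y thetabar
  (palg_lift_monoid thetabarC thetabar_rel).

Lemma thetabar_J a : thetabar (J a) = J a.
Proof. exact: (palg_liftE thetabarC thetabar_rel). Qed.
Lemma thetabar_Jh a : thetabar (Jh a) = - Jh a.
Proof. exact: (palg_liftE thetabarC thetabar_rel). Qed.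
Lemma thetabarZ (p : A) (y : Y) : thetabar (p *: y) = (p \Po (- 'X)) *: thetabar y.
Proof. by rewrite /thetabar (palg_liftZ thetabarC thetabar_rel) /= mulr_algl. Qed.
Lemma thetabar_alpha : thetabar (alpha *: 1) = - (alpha *: 1).
Proof. by rewrite thetabarZ rmorph1 comp_polyX scaleNr. Qed.

Lemma negXK p : (p \Po (- 'X)) \Po (- 'X) = p :> A.
Proof. by rewrite -comp_polyA linearN /= comp_polyX opprK comp_polyXr. Qed.

Lemma thetabar_involutive : involutive thetabar.
Proof.
elim/palg_ind=> x; elim: x => [[a|a]|p|x IHx y IHy|x IHx y IHy].
- by rewrite -[cls _ _]/(J a) !thetabar_J.
- by rewrite -[cls _ _]/(Jh a) thetabar_Jh rmorphN /= thetabar_Jh opprK.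
- by rewrite cls_scal !thetabarZ !rmorph1 negXK.
- by rewrite -cls_addE !rmorphD /= IHx IHy.
- by rewrite -cls_mulE !rmorphM /= IHx IHy.
Qed.


Definition coproduct_gen (g : Ygen) : YY :=
  match g with
  | Lv0 a => J a ⊗ 1 + 1 ⊗ J a
  | Lv1 H0 => Jh H0 ⊗ 1 + 1 ⊗ Jh H0 -
      alpha *: (J Ep ⊗ J Em - J Em ⊗ J Ep)
  | Lv1 Ep => Jh Ep ⊗ 1 + 1 ⊗ Jh Ep +
      (2^-1 *: alpha) *: (J Ep ⊗ J H0 - J H0 ⊗ J Ep)
  | Lv1 Em => Jh Em ⊗ 1 + 1 ⊗ Jh Em -
      (2^-1 *: alpha) *: (J Em ⊗ J H0 - J H0 ⊗ J Em)
  end.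

Definition beta : YY := in_alg YY (2^-1 *: alpha).
Definition leval (x : letter) : YY :=
  let: (r, l, a) := x in
  let u := Jgen (if l then Lv1 a else Lv0 a) in
  if r then 1 ⊗ u else u ⊗ 1.

Lemma betaC (x : YY) : beta * x = x * beta. Proof. exact: in_algC. Qed.

Lemma ptens_intl (u v : Y) (n : int) : (u *~ n) ⊗ v = (u ⊗ v) *~ n.
Proof. by rewrite -!scaler_int ptensZl. Qed.
Lemma ptens_intr (u v : Y) (n : int) : u ⊗ (v *~ n) = (u ⊗ v) *~ n.
Proof. by rewrite -!scaler_int ptensZr. Qed.

Lemma leval_rule x y n z : rule x y = Some (n, z) ->
  leval x * leval y = leval y * leval x + leval z *~ n.
Proof.
have comm u v w (m : int) : u * v - v * u = w *~ m -> u * v = v * u + w *~ m :> Y.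
  by move=> <-; rewrite addrC subrK.
case: x => [[rx lx] a]; case: y => [[ry ly] b] /=.
case: rx; case: ry => //=.
- case: lx => //; case: ifP => // _ [<- <-] /=.
  rewrite !ptensM !mul1r -ptens_intr -ptensDr; congr (_ ⊗ _).
  by case: ly; [exact/comm/J_Jh_comm | exact/comm/J_comm].
- by case=> <- <-; rewrite mulr0z addr0 !ptensM !mul1r !mulr1.
- case: lx => //; case: ifP => // _ [<- <-] /=.
  rewrite !ptensM !mul1r -ptens_intl -ptensDl; congr (_ ⊗ _).
  by case: ly; [exact/comm/J_Jh_comm | exact/comm/J_comm].
Qed.

Definition coproduct_poly (g : Ygen) : ncpoly :=
  let l0 a := (false, false, a) in let r0 a := (true, false, a) in
  let l1 a := (false, true, a) in let r1 a := (true, true, a) in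
  match g with
  | Lv0 a => [:: (1, 0%N, [:: l0 a]); (1, 0%N, [:: r0 a])]
  | Lv1 H0 => [:: (1, 0%N, [:: l1 H0]); (1, 0%N, [:: r1 H0]);
      (-2, 1%N, [:: l0 Ep; r0 Em]); (2, 1%N, [:: l0 Em; r0 Ep])]
  | Lv1 Ep => [:: (1, 0%N, [:: l1 Ep]); (1, 0%N, [:: r1 Ep]);
      (1, 1%N, [:: l0 Ep; r0 H0]); (-1, 1%N, [:: l0 H0; r0 Ep])]
  | Lv1 Em => [:: (1, 0%N, [:: l1 Em]); (1, 0%N, [:: r1 Em]);
      (-1, 1%N, [:: l0 Em; r0 H0]); (1, 1%N, [:: l0 H0; r0 Em])]
  end.

Local Notation ev := (pev beta leval).

Lemma coproduct_polyE g : ev (coproduct_poly g) = coproduct_gen g.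
Proof.
have b2 (x : YY) : alpha *: x = (beta * x) *~ 2.
  rewrite /beta mulr_algl -scaler_int scalerA; congr (_ *: _).
  by rewrite -scalerAr mulrzl -pmulrn -scaler_nat scalerA mulVf ?pnatr_eq0 ?scale1r.
case: g => [a|[||]]; rewrite /coproduct_poly !pev_cons pev_nil addr0 /mev /=;
  rewrite ?(expr0, expr1, mulr1z, mulr1, mul1r) //;
  rewrite !ptensM !(mul1r, mulr1) -?addrA; do 2!congr (_ + _).
- by rewrite mulrN1z -mulrBr /beta mulr_algl.
- by rewrite mulrN1z addrC -mulrBr /beta mulr_algl -scalerN opprB.
- by rewrite b2 mulrBr mulrzBl opprB addrC mulrNz.
Qed.


(* The difference of the two sides of the last relation, as a polynomial in
   the images [p g] of the generators; α^2 is 4 (α/2)^2. *)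
Definition serre_poly (p : Ygen -> ncpoly) : ncpoly :=
  psub (pcom (p (Lv1 H0)) (pcom (p (Lv1 Ep)) (p (Lv1 Em))))
    (pscale 4 2 (pmul (psub (pmul (p (Lv1 Em)) (p (Lv0 Ep)))
                            (pmul (p (Lv0 Em)) (p (Lv1 Ep)))) (p (Lv0 H0)))).

Definition serre_eval (v : Ygen -> YY) : YY :=
  (v (Lv1 H0) * (v (Lv1 Ep) * v (Lv1 Em) - v (Lv1 Em) * v (Lv1 Ep)) -
   (v (Lv1 Ep) * v (Lv1 Em) - v (Lv1 Em) * v (Lv1 Ep)) * v (Lv1 H0)) -
  alpha ^+ 2 *: ((v (Lv1 Em) * v (Lv0 Ep) - v (Lv0 Em) * v (Lv1 Ep)) *
                 v (Lv0 H0)).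

Lemma beta2 (x : YY) : (beta ^+ 2 * x) *~ 4 = alpha ^+ 2 *: x.
Proof.
rewrite /beta -rmorphXn mulr_algl exprZn -scaler_int scalerA; congr (_ *: _).
rewrite -scalerAr mulrzl -pmulrn -scaler_nat scalerA.
by rewrite (_ : _ * _ = 1) ?scale1r //; field.
Qed.

Lemma serre_polyE p : ev (serre_poly p) = serre_eval (fun g => ev (p g)).
Proof.
by rewrite !(pev_sub, pev_com leval betaC, pev_mul leval betaC, pev_scale, beta2) /serre_eval.
Qed.

Definition letter_poly (r : bool) (g : Ygen) : ncpoly :=
  [:: (1, 0%N, [:: match g with Lv0 a => (r, false, a)
                              | Lv1 a => (r, true, a) end])].

Lemma letter_polyE r g :
  ev (letter_poly r g) = if r then 1 ⊗ Jgen g else Jgen g ⊗ 1.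
Proof.
rewrite pev_cons pev_nil addr0 /mev /= expr0 mul1r mulr1z mulr1.
by case: g => a; case: r.
Qed.

Lemma serre_eval_eq v v' : v =1 v' -> serre_eval v = serre_eval v'.
Proof. by move=> h; rewrite /serre_eval !h. Qed.

Lemma serre_letter r : ev (serre_poly (letter_poly r)) = 0.
Proof.
rewrite serre_polyE (serre_eval_eq (letter_polyE r)) /serre_eval.
case: r; rewrite !ptensM !mul1r -?ptensBl -?ptensBr !ptensM ?mul1r.
  by rewrite -ptensBr -ptensZr -ptensBr Jh_serre subrr ptens0r.
by rewrite -ptensBl -ptensZl -ptensBl Jh_serre subrr ptens0l.
Qed.

Lemma serre_coproduct : serre_eval coproduct_gen = 0.
Proof.
rewrite -(serre_eval_eq coproduct_polyE) -serre_polyE.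
have /(pzeroP betaC leval_rule) : pzero (psub (serre_poly coproduct_poly)
  (serre_poly (letter_poly false) ++ serre_poly (letter_poly true))).
  by vm_compute.
by rewrite pev_sub pev_cat !serre_letter addr0 subr0.
Qed.

Fact coproduct_rel x y : Yrel x y ->
  aeval (in_alg YY) coproduct_gen x = aeval (in_alg YY) coproduct_gen y.
Proof.
have comm g h n k :
  pzero (psub (pcom (coproduct_poly g) (coproduct_poly h))
              (pscale n 0 (coproduct_poly k))) ->
  coproduct_gen g * coproduct_gen h - coproduct_gen h * coproduct_gen g =
  n%:~R%:A * coproduct_gen k.
  move/(pzeroP betaC leval_rule)/eqP.
  rewrite pev_sub (pev_com leval betaC) pev_scale expr0 mul1r subr_eq0.
  by rewrite !coproduct_polyE => /eqP ->; rewrite mulr_algl scaler_int.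
case=> [a b|a b|].
- by rewrite aeval_tcom; apply: (comm (Lv0 a) (Lv0 b) _ (Lv0 _));
    case: a; case: b; vm_compute.
- by rewrite aeval_tcom; apply: (comm (Lv0 a) (Lv1 b) _ (Lv1 _));
    case: a; case: b; vm_compute.
- apply/eqP; rewrite -subr_eq0 -[X in _ == X]serre_coproduct /serre_eval.
  by rewrite !(aeval_tcom, aeval_tsub) /= mulr_algl !scaleN1r !mulN1r.
Qed.

Definition coproduct : Y -> YY := palg_lift (in_alg YY) coproduct_gen.

HB.instance Definition _ := GRing.isZmodMorphism.Build Y YY coproduct
  (palg_lift_zmod (@in_algC YY) coproduct_rel).
HB.instance Definition _ := GRing.isMonoidMorphism.Build Y YY coproduct
  (palg_lift_monoid (@in_algC YY) coproduct_rel).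

Fact coproductZ : scalable coproduct.
Proof.
move=> a u; rewrite /coproduct (palg_liftZ (@in_algC YY) coproduct_rel).
by rewrite /= mulr_algl.
Qed.
HB.instance Definition _ := GRing.isScalable.Build A Y YY *:%R coproduct
  coproductZ.

Lemma coproduct_Jgen g : coproduct (Jgen g) = coproduct_gen g.
Proof. exact: (palg_liftE (@in_algC YY) coproduct_rel). Qed.

Lemma coproduct_Jh (a : sl2) :
  coproduct (Jh a) = Jh a ⊗ 1 + 1 ⊗ Jh a +
    (2^-1 *: alpha) *: \sum_b \sum_c (sl2_f K a b c)%:P *: (J b ⊗ J c).
Proof.
have half : alpha = (2^-1 *: alpha) * 2%:P.
  by rewrite mulrC mul_polyC scalerA mulfV ?pnatr_eq0 ?scale1r.
rewrite coproduct_Jgen !big_sl2 !sl2_fE; case: a => /=;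
  rewrite !(scale0r, addr0, add0r, scale1r, scaleN1r, polyC0, polyC1, polyCN) //.
- by rewrite -scalerN opprB [- _ + _]addrC.
- rewrite scaleNr [- _ + _]addrC -scalerBr scalerA -half -scalerN opprB.
  by [].
Qed.

End Yangian.

Section TwistedYangian.
Variable K : numFieldType.
Local Notation A := {poly K}.
Local Notation Y := (Y K).
Local Notation J := (@J K).
Local Notation Jh := (@Jh K).
Local Notation alpha := (@alpha K).

Definition com (x y : Y) : Y := x * y - y * x.

Definition level2 (a : sl2) : Y :=
  ((sl2_cg K)^-1)%:P *:
    \sum_b \sum_c (sl2_f K a b c)%:P *: com (Jh c) (Jh b).

Definition twisted_level2 (t : K) (a : sl2) : Y :=
  level2 a + (alpha * t%:P) *: Jh a +
  (alpha * (4^-1)%:P) *: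
    \sum_b \sum_c (sl2_f K a b c)%:P *: (Jh b * J c + J c * Jh b).

(* A θ̄-fixed set is not stable under all of [{poly K}]: its scalars are those
   fixed by θ̄, the polynomials in α^2. *)
Definition subalgebra (B : set Y) : Prop :=
  [/\ B 1, (forall x y, B x -> B y -> B (x - y)),
      (forall x y, B x -> B y -> B (x * y)) &
      (forall (p : A) x, p \Po (- 'X) = p -> B x -> B (p *: x))].

Definition generated_subalgebra (S : set Y) : set Y := smallest subalgebra S.

Definition left_coideal (B : set Y) : Prop :=
  forall b, B b -> exists2 s : seq (Y * Y),
    (forall p, p \in s -> B p.2) &
    coproduct b = \sum_(p <- s) p.1 ⊗ p.2.

Definition twisted_yangian (t : K) : set Y :=
  generated_subalgebra (range J `|` range (twisted_level2 t)).

Definition tildeEp (t : K) : Y :=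
  (2^-1)%:P *: (com (Jh H0) (Jh Ep) +
    alpha *: (t%:P *: Jh Ep + J H0 * Jh Ep - J Ep * Jh H0)).

Definition tildeEm (t : K) : Y :=
  (- 2^-1)%:P *: (com (Jh H0) (Jh Em) +
    alpha *: (- (t%:P *: Jh Em) + J H0 * Jh Em - J Em * Jh H0)).

Definition tildeH (t : K) : Y := com (tildeEp t) (J Em).

End TwistedYangian.

(* Main.v *)
(* With t' = t/2 + 1, the commutation relations turn the generators
   ĵĵ^a + α t' ĵ^a + (α/4) f^a_{bc} {ĵ^b, j^c} into the given ones. Since
   Δ is an algebra morphism, only Δ(Ẽ^±) has to be examined: the terms
   α E^± ⊗ Ĥ and α H ⊗ Ê^± coming from [Ĥ, Ê^±] are cancelled by those coming
   from α(H Ê^± - E^± Ĥ), so Δ(Ẽ^±) - 1 ⊗ Ẽ^± has level-zero right factors. *)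
Require Import Defs.
From mathcomp Require Import all_boot all_order all_algebra.
From mathcomp Require Import complex ring.
From mathcomp Require Import boolp classical_sets reals.

Set Implicit Arguments.
Unset Strict Implicit.
Unset Printing Implicit Defensive.

Import Order.TTheory GRing.Theory Num.Theory.
Local Open Scope classical_set_scope.
Local Open Scope ring_scope.
Local Open Scope complex_scope.

(** * Subalgebras and tensors with right factors in a subalgebra *)

Section Subalgebra.
Variable K : numFieldType.
Local Notation A := {poly K}.
Local Notation Y := (Y K).
Implicit Types (B S : set Y) (x y : Y).

Lemma generated_subalgebraP S : subalgebra (generated_subalgebra S).
Proof.
split=> [|x y hx hy|x y hx hy|p x hp hx] C [hC SC].
- by case: hC.
- by case: (hC) => _ h _ _; apply: h; [apply: hx | apply: hy].
- by case: (hC) => _ _ h _; apply: h; [apply: hx | apply: hy].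
- by case: (hC) => _ _ _ h; apply: h => //; apply: hx.
Qed.

Lemma thetabar_fixed_subalgebra : subalgebra [set b : Y | thetabar b = b].
Proof.
split=> /= [|x y hx hy|x y hx hy|p x hp hx].
- exact: rmorph1.
- by rewrite rmorphB /= hx hy.
- by rewrite rmorphM /= hx hy.
- by rewrite thetabarZ hp hx.
Qed.

(** The image of Y ⊗ B in Y ⊗ Y, phrased so that [left_coideal B] unfolds to membership of
    coproducts in this set. *)
Definition tens_right B : set (YY K) :=
  [set x | exists2 s : seq (Y * Y),
     (forall p, p \in s -> B p.2) & x = \sum_(p <- s) p.1 ⊗ p.2].

Lemma tens_right_ptens B u v : B v -> tens_right B (u ⊗ v).
Proof.
move=> Bv; exists [:: (u, v)]; last by rewrite big_seq1.
by move=> p; rewrite inE => /eqP ->.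
Qed.

Lemma tens_rightD B (x y : YY K) :
  tens_right B x -> tens_right B y -> tens_right B (x + y).
Proof.
move=> [s hs ->] [r hr ->]; exists (s ++ r); last by rewrite big_cat.
by move=> p; rewrite mem_cat => /orP[/hs|/hr].
Qed.

(** The left factor absorbs the scalar, so α itself is allowed, while [subalgebra] only asks for
    closure under polynomials in α^2. *)
Lemma tens_rightZ B (a : A) (x : YY K) : tens_right B x -> tens_right B (a *: x).
Proof.
move=> [s hs ->]; exists [seq (a *: p.1, p.2) | p <- s].
  by move=> p /mapP[q /hs hq ->].
by rewrite big_map scaler_sumr; apply: eq_bigr => p _; rewrite ptensZl.
Qed.

Lemma tens_rightB B (x y : YY K) :
  tens_right B x -> tens_right B y -> tens_right B (x - y).
Proof. by move=> hx hy; rewrite -scaleN1r; apply/tens_rightD/tens_rightZ. Qed.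

Lemma tens_rightM B (x y : YY K) : subalgebra B ->
  tens_right B x -> tens_right B y -> tens_right B (x * y).
Proof.
move=> [_ _ BM _] [s hs ->] [r hr ->].
exists [seq (p.1 * q.1, p.2 * q.2) | p <- s, q <- r].
  by move=> _ /allpairsP[[p q] /= [/hs hp /hr hq ->]]; apply: BM.
rewrite big_distrl big_allpairs_dep /=; apply: eq_bigr => p _.
by rewrite big_distrr; apply: eq_bigr => q _ /=; rewrite ptensM.
Qed.

(** Δ is an algebra morphism and tensors with right factors in B are stable under products, so the
    coideal property can be tested on generators. *)
Lemma coproduct_preimage_subalgebra B : subalgebra B ->
  subalgebra [set b : Y | tens_right B (coproduct b)].
Proof.
move=> hB; split=> /= [|x y hx hy|x y hx hy|p x _ hx].
- by rewrite rmorph1; apply: tens_right_ptens; case: hB.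
- by rewrite rmorphB; apply: tens_rightB.
- by rewrite rmorphM; apply: tens_rightM.
- by rewrite linearZ; apply: tens_rightZ.
Qed.

(* No letter of level one occurs in the right tensor factor. *)
Definition right_level0 (p : ncpoly) : bool :=
  all (fun m => (m.1.1 == 0) || all (fun x : letter => ~~ (x.1.1 && x.1.2)) m.2) p.

Lemma pev_right_level0 B p : subalgebra B -> (forall a, B (@J K a)) ->
  right_level0 p -> tens_right B (pev (beta K) (leval K) p).
Proof.
move=> hB BJ; have B1 : B 1 by case: hB.
elim: p => [_|[[c n] w] p IH /= /andP[hm /IH hp]].
  by rewrite pev_nil -(scale0r 1); apply/tens_rightZ/tens_right_ptens.
rewrite pev_cons; apply: tens_rightD => //; rewrite /mev /=.
(* Collecting like terms leaves cancelled monomials in the list with coefficient 0; their words are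
   unrestricted. *)
case/orP: hm => [/eqP ->|hw].
  by rewrite mulr0z -(scale0r 1); apply/tens_rightZ/tens_right_ptens.
rewrite /beta -rmorphXn mulr_algl -scaler_int.
do 2!apply: tens_rightZ.
elim: w hw {hp IH} => [_|[[r l] a] w IH /= /andP[hx /IH hw]] /=.
  exact: tens_right_ptens.
apply: tens_rightM => //.
by case: r l hx => -[] // _; apply: tens_right_ptens => //; apply: BJ.
Qed.

End Subalgebra.

(** * The part of the generators free of t, as noncommutative polynomials *)

Section Generators.
Variable K : numFieldType.
Local Notation A := {poly K}.
Local Notation Y := (Y K).
Local Notation J := (@J K).
Local Notation Jh := (@Jh K).
Local Notation alpha := (@alpha K).
Local Notation ev := (pev (beta K) (leval K)).

(* [tildeEp 0] and [- tildeEm 0], up to the factor 2. *)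
Definition tilde_core (a : sl2) : Y :=
  com (Jh H0) (Jh a) + alpha *: (J H0 * Jh a - J a * Jh H0).

(* [pscale 2 1] multiplies by 2 (α/2) = α. *)
Definition tilde_core_poly (a : sl2) (p : Ygen -> ncpoly) : ncpoly :=
  pcom (p (Lv1 H0)) (p (Lv1 a)) ++
  pscale 2 1 (psub (pmul (p (Lv0 H0)) (p (Lv1 a)))
                   (pmul (p (Lv0 a)) (p (Lv1 H0)))).

Lemma tilde_core_polyE a p : ev (tilde_core_poly a p) =
  (ev (p (Lv1 H0)) * ev (p (Lv1 a)) - ev (p (Lv1 a)) * ev (p (Lv1 H0))) +
  alpha *: (ev (p (Lv0 H0)) * ev (p (Lv1 a)) - ev (p (Lv0 a)) * ev (p (Lv1 H0))).
Proof.
rewrite pev_cat pev_scale (pev_com _ (@betaC K)) pev_sub !(pev_mul _ (@betaC K)) expr1.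
congr (_ + _); rewrite /beta mulr_algl -scaler_int scalerA; congr (_ *: _).
by rewrite -scalerAr mulrzl -pmulrn -scaler_nat scalerA mulVf ?pnatr_eq0 ?scale1r.
Qed.

(** Δ and x ↦ 1 ⊗ x are both algebra morphisms, so the two images of [tilde_core a] are values of
    one polynomial expression, at [coproduct_poly] and at [letter_poly true]. Their difference can
    then be computed on lists of monomials. *)
Lemma coproduct_core a : ev (tilde_core_poly a coproduct_poly) = coproduct (tilde_core a).
Proof.
rewrite /tilde_core /com rmorphD /= linearZ /= !rmorphB /= !rmorphM /=.
by rewrite !coproduct_Jgen -!coproduct_polyE tilde_core_polyE.
Qed.

Lemma ptens_core a : ev (tilde_core_poly a (letter_poly true)) = 1 ⊗ tilde_core a.
Proof.
rewrite tilde_core_polyE !letter_polyE /tilde_core /com.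
by rewrite ptensDr ptensZr !ptensBr !ptensM mulr1.
Qed.

(** * Deviation of the coproduct from x ↦ 1 ⊗ x *)

Section CoproductDefect.
Variable B : set Y.
Hypotheses (hB : subalgebra B) (BJ : forall a, B (J a)).

(** Linear over all polynomials in α, so it can be treated term by term, even on summands not known
    to lie in B; only the total has to lie in B, to restore the term 1 ⊗ x. *)
Definition coproduct_defect (x : Y) : YY K := coproduct x - 1 ⊗ x.

Lemma coproduct_defectD x y : tens_right B (coproduct_defect x) ->
  tens_right B (coproduct_defect y) -> tens_right B (coproduct_defect (x + y)).
Proof.
by move=> hx hy; rewrite /coproduct_defect linearD ptensDr opprD addrACA;
   apply: tens_rightD.
Qed.

Lemma coproduct_defectZ (c : A) x : tens_right B (coproduct_defect x) ->
  tens_right B (coproduct_defect (c *: x)).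
Proof.
by move=> hx; rewrite /coproduct_defect linearZ ptensZr -scalerBr;
   apply: tens_rightZ.
Qed.

Lemma coproduct_defect_coideal x :
  tens_right B (coproduct_defect x) -> B x -> tens_right B (coproduct x).
Proof.
by move=> hx Bx; rewrite -[coproduct x](subrK (1 ⊗ x));
   apply/tens_rightD/tens_right_ptens.
Qed.

(** Removing 1 ⊗ ĵ^a from Δ(ĵ^a) leaves ĵ^a ⊗ 1 and tensors of level-zero elements. *)
Lemma coproduct_defect_Jgen g : tens_right B (coproduct_defect (Jgen K g)).
Proof.
rewrite /coproduct_defect coproduct_Jgen -coproduct_polyE.
have <- /= := letter_polyE K true g.
pose p := psub (coproduct_poly g) (letter_poly true g).
have [q /andP[/(pzeroP (@betaC K) (@leval_rule K)) pq hq]] :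
    exists q, pzero (psub p q) && right_level0 q.
  (* The witness is the normal form of [p], with words straightened and like monomials collected:
     there the two opposite occurrences of 1 ⊗ ĵ^a merge into one monomial with coefficient 0. *)
  exists (foldr collect1 [::] (psubst nfw p)).
  by rewrite {}/p; case: g => -[]; vm_compute.
rewrite -pev_sub -/p -[ev p](subrK (ev q)) -pev_sub pq add0r.
exact: pev_right_level0.
Qed.

(** For E^+, [1 ⊗ Ĥ, -(α/2) H ⊗ E^+] gives -α H ⊗ Ê^+ and [-α E^+ ⊗ E^-, 1 ⊗ Ê^+] gives α E^+ ⊗ Ĥ;
    the α-terms of the core cancel both. The case E^- is similar, and for [H0] the core vanishes. *)
Lemma coproduct_defect_core a : tens_right B (coproduct_defect (tilde_core a)).
Proof.
rewrite /coproduct_defect -coproduct_core -ptens_core -pev_sub.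
set p := psub _ _.
have [q /andP[/(pzeroP (@betaC K) (@leval_rule K)) pq hq]] :
    exists q, pzero (psub p q) && right_level0 q.
  exists (foldr collect1 [::] (psubst nfw p)).
  by rewrite {}/p; case: a; vm_compute.
rewrite -[ev p](subrK (ev q)) -pev_sub pq add0r.
exact: pev_right_level0.
Qed.

End CoproductDefect.

(** * The given generators compared with those of the general definition *)

Lemma tildeEpE t :
  tildeEp t = (2^-1)%:P *: tilde_core Ep + ((2^-1)%:P * alpha * t%:P) *: Jh Ep.
Proof.
rewrite /tildeEp /tilde_core -(addrA (t%:P *: _)).
move: (com _ _) (J H0 * _ - _) => x y.
by rewrite (scalerDr alpha) !scalerDr !scalerA !mulrA addrA addrAC.
Qed.

Lemma tildeEmE t :
  tildeEm t = (- 2^-1)%:P *: tilde_core Em + ((2^-1)%:P * alpha * t%:P) *: Jh Em.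
Proof.
rewrite /tildeEm /tilde_core -(addrA (- (t%:P *: _))).
move: (com _ _) (J H0 * _ - _) => x y.
rewrite (scalerDr alpha) scalerN !scalerDr scalerN -scaleNr polyCN opprK !scalerA.
by rewrite addrA addrAC.
Qed.

Lemma sl2_halves : [/\ (2^-1)%:P *+ 2 = 1 :> A & (4^-1)%:P *+ 2 = (2^-1)%:P :> A].
Proof.
by split; rewrite -polyCMn; congr (_%:P); field.
Qed.

(** Two structure constants are nonzero and contribute the same bracket, so 1/c_g = 1/4 becomes
    1/2. *)
Lemma level2_Ep : level2 K Ep = (2^-1)%:P *: com (Jh H0) (Jh Ep).
Proof.
have [_ <-] := sl2_halves; rewrite /level2 !big_sl2 !sl2_fE /=.
rewrite !(polyC0, polyC1, polyCN, scale0r, scale1r, scaleN1r, addr0, add0r).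
by rewrite /com opprB -mulr2n -scalerMnl -scalerMnr.
Qed.
Lemma level2_Em : level2 K Em = (- 2^-1)%:P *: com (Jh H0) (Jh Em).
Proof.
have [_ h4] := sl2_halves; rewrite polyCN -h4 /level2 !big_sl2 !sl2_fE /=.
rewrite !(polyC0, polyC1, polyCN, scale0r, scale1r, scaleN1r, addr0, add0r).
rewrite /com -(opprB (Jh H0 * Jh Em)) -opprD -mulr2n.
by rewrite scalerN scaleNr -scalerMnl -scalerMnr.
Qed.

Lemma Jh_J_swap a b :
  Jh b * J a = J a * Jh b - Jh (sl2_br a b).2 *~ (sl2_br a b).1.
Proof. by rewrite -J_Jh_comm subKr. Qed.

(** Here x and y stand for the ordered products and z for the commutator correction that each of two
    reorderings produces. *)
Lemma add_antisymmetrized (V : zmodType) (x y z : V) :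
  x - z + x - (y + z + y) = (x - y - z) *+ 2.
Proof. by rewrite mulr2n !opprD !addrA [LHS](ACl (1*4*2*3*6*5)). Qed.

Lemma quarterZ (x y : Y) :
  (alpha * (4^-1)%:P) *: ((x - y *+ 2) *+ 2) =
  (alpha * (2^-1)%:P) *: x - alpha *: y.
Proof.
have [h2 h4] := sl2_halves.
rewrite -scalerMnr scalerMnl -mulrnAr h4 scalerBr; congr (_ - _).
by rewrite -scalerMnr scalerMnl -mulrnAr h2 mulr1.
Qed.

Lemma shiftZ (s : K) (x y : Y) :
  (alpha * s%:P) *: x + (y - alpha *: x) = y + (alpha * (s%:P - 1)) *: x.
Proof. by rewrite addrCA mulrBr mulr1 scalerBl. Qed.

(** Moving level-zero factors to the left costs 2 Ê^+ for each of the two structure constants; after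
    the factor α/4 this is -α Ê^+, whence s - 1. The shift is the same for Ê^- and Ĥ. *)
Lemma twisted_level2_Ep s :
  twisted_level2 s Ep = (2^-1)%:P *: tilde_core Ep + (alpha * (s%:P - 1)) *: Jh Ep.
Proof.
rewrite /twisted_level2 level2_Ep !big_sl2 !sl2_fE /=.
rewrite !(polyC0, polyC1, polyCN, scale0r, scale1r, scaleN1r, addr0, add0r).
rewrite (Jh_J_swap H0 Ep) (Jh_J_swap Ep H0) /= !mulrNz opprK.
rewrite add_antisymmetrized quarterZ -addrA shiftZ addrA.
by rewrite /tilde_core [in RHS]scalerDr scalerA [alpha * (2^-1)%:P]mulrC.
Qed.

Lemma twisted_level2_Em s :
  twisted_level2 s Em = (- 2^-1)%:P *: tilde_core Em + (alpha * (s%:P - 1)) *: Jh Em.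
Proof.
rewrite /twisted_level2 level2_Em !big_sl2 !sl2_fE /=.
rewrite !(polyC0, polyC1, polyCN, scale0r, scale1r, scaleN1r, addr0, add0r).
rewrite (Jh_J_swap H0 Em) (Jh_J_swap Em H0) /= !mulrNz opprK.
rewrite [- (_ + _) + _]addrC add_antisymmetrized quarterZ -addrA shiftZ addrA.
rewrite /tilde_core [in RHS]scalerDr scalerA -[J Em * Jh H0 - _]opprB scalerN -scaleNr.
by rewrite mulNr [alpha * (2^-1)%:P]mulrC.
Qed.

Lemma level2_H0 : level2 K H0 = com (Jh Ep) (Jh Em).
Proof.
have [_ h4] := sl2_halves; rewrite /level2 !big_sl2 !sl2_fE /=.
rewrite !(polyC0, polyCN, scale0r, addr0, add0r) scaleNr -scalerN opprB -/(com _ _).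
rewrite -mulr2n -scalerMnr scalerMnl h4 scalerA -polyCM mulVf ?pnatr_eq0 //.
by rewrite polyC1 scale1r.
Qed.

Lemma twisted_level2_H0 s :
  twisted_level2 s H0 = com (Jh Ep) (Jh Em) +
    alpha *: (J Ep * Jh Em - J Em * Jh Ep) + (alpha * (s%:P - 1)) *: Jh H0.
Proof.
have [h2 _] := sl2_halves.
rewrite /twisted_level2 level2_H0 !big_sl2 !sl2_fE /=.
rewrite !(polyC0, polyCN, scale0r, addr0, add0r).
rewrite (Jh_J_swap Ep Em) (Jh_J_swap Em Ep) /= !mulrNz opprK !mulr1z scaleNr.
rewrite [- (_ *: (_ + _)) + _]addrC -scalerBr add_antisymmetrized.
(* The structure constant 2 is distributed over the difference, so that the correction Ĥ appears
   doubled, as [quarterZ] expects. *)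
rewrite polyCMn !scaler_nat mulrnBl quarterZ -addrA shiftZ addrA.
by rewrite -scalerMnr scalerMnl -mulrnAr h2 mulr1.
Qed.

(** * Commutators with E^- and the generator of weight zero *)

Lemma com_mull (x y z : Y) : com (x * y) z = x * com y z + com x z * y.
Proof. by rewrite /com mulrBr mulrBl !mulrA addrA subrK. Qed.

Lemma comDl (x y z : Y) : com (x + y) z = com x z + com y z.
Proof. by rewrite /com mulrDl mulrDr opprD addrACA. Qed.

Lemma comNl (x y : Y) : com (- x) y = - com x y.
Proof. by rewrite /com mulNr mulrN opprB addrC opprK. Qed.

Lemma comZl (c : A) (x y : Y) : com (c *: x) y = c *: com x y.
Proof. by rewrite /com -scalerAl -scalerAr scalerBr. Qed.

Lemma com_Jh_J a b : com (Jh a) (J b) = - (Jh (sl2_br b a).2 *~ (sl2_br b a).1).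
Proof. by rewrite -J_Jh_comm opprB. Qed.

Lemma com_tilde_core_Em : com (tilde_core Ep) (J Em) =
  (com (Jh Ep) (Jh Em) + alpha *: (J Ep * Jh Em - J Em * Jh Ep)) *+ 2.
Proof.
rewrite /tilde_core comDl comZl [com (Jh H0) (Jh Ep)]/com !(comDl, comNl) !com_mull.
rewrite !com_Jh_J {1 2}/com !J_comm /= !mulrNz !opprK !mulr1z.
(* [v] is Ĥ Ĥ for the bracket [Ĥ, Ê^+] and H Ĥ for the α-term; it cancels in both, and the weight of
   E^- gives the common factor 2. *)
have collect (x y z u v : Y) :
    v - (x *~ 2) * y - (- (z * (u *~ 2)) + v) = (z * u - x * y) *+ 2.
  rewrite addrC opprD opprK addrA subrK.
  by rewrite mulrzAr mulrzAl mulrnBl.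
by rewrite !mulNr !mulrN !collect -scalerMnr -mulrnDl.
Qed.

Lemma tildeHE t : tildeH t = com (Jh Ep) (Jh Em) +
    alpha *: (J Ep * Jh Em - J Em * Jh Ep) + ((2^-1)%:P * alpha * t%:P) *: Jh H0.
Proof.
have [h2 _] := sl2_halves.
rewrite /tildeH tildeEpE comDl !comZl com_tilde_core_Em com_Jh_J /= mulrNz opprK mulr1z.
by rewrite -scalerMnr scalerMnl h2 scale1r.
Qed.

(** In s = t/2 + 1 the summand 1 offsets the reordering shift, and 1/2 is the overall factor of the
    given generators. *)
Lemma twisted_level2_tilde (t : K) :
  let s := 2^-1 * t + 1 in
  [/\ twisted_level2 s Ep = tildeEp t, twisted_level2 s Em = tildeEm t &
      twisted_level2 s H0 = tildeH t].
Proof.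
rewrite /= twisted_level2_Ep twisted_level2_Em twisted_level2_H0.
rewrite tildeEpE tildeEmE tildeHE polyCD polyC1 addrK polyCM.
by rewrite mulrA [alpha * _]mulrC.
Qed.

(** The generators agree one by one, so the generating sets themselves coincide. *)
Lemma tilde_subalgebraE (t : K) :
  generated_subalgebra (range J `|` [set tildeEp t; tildeEm t; tildeH t]) =
  twisted_yangian (2^-1 * t + 1).
Proof.
rewrite /twisted_yangian; congr (generated_subalgebra (_ `|` _)).
have [<- <- <-] := twisted_level2_tilde t.
apply/seteqP; split=> [x [[]|] ->|_ [[] _ <-]].
- by exists Ep.
- by exists Em.
- by exists H0.
- by left; left.
- by left; right.
- by right.
Qed.

(** * Invariance under θ̄ and the left coideal property *)

Section TwistedYangian.
Variable t : K.
Let S : set Y := range J `|` [set tildeEp t; tildeEm t; tildeH t].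
Let B := generated_subalgebra S.

Lemma thetabar_com (x y : Y) : thetabar (com x y) = com (thetabar x) (thetabar y).
Proof. by rewrite /com rmorphB !rmorphM. Qed.

Lemma com_subalgebra (C : set Y) x y : subalgebra C -> C x -> C y -> C (com x y).
Proof. by move=> [_ CB CM _] Cx Cy; apply: CB; apply: CM. Qed.

Lemma alpha_level1_fixed (x : Y) :
  thetabar x = - x -> thetabar (alpha *: x) = alpha *: x.
Proof. by move=> hx; rewrite thetabarZ comp_polyX scaleNr hx scalerN opprK. Qed.

Lemma tilde_core_fixed a : thetabar (tilde_core a) = tilde_core a.
Proof.
rewrite /tilde_core rmorphD /= thetabar_com !thetabar_Jh /com !mulrNN.
rewrite alpha_level1_fixed // rmorphB !rmorphM /= !thetabar_J !thetabar_Jh.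
by rewrite !mulrN opprB opprK addrC.
Qed.

(** The fixed points form a subalgebra, so generators suffice; in each of their terms the factors α
    and ĵ^a, all of which change sign, are even in number. *)
Lemma thetabar_generated b : B b -> thetabar b = b.
Proof.
apply: (smallest_sub (thetabar_fixed_subalgebra K)) => {b} x Sx /=.
have scal_fix (c d : K) a : thetabar ((c%:P * alpha * d%:P) *: Jh a) =
    (c%:P * alpha * d%:P) *: Jh a.
  rewrite thetabarZ !rmorphM /= !comp_polyC comp_polyX thetabar_Jh.
  by rewrite mulrN mulNr scaleNr scalerN opprK.
have Ep_fix : thetabar (tildeEp t) = tildeEp t.
  by rewrite tildeEpE rmorphD /= scal_fix thetabarZ comp_polyC tilde_core_fixed.
have Em_fix : thetabar (tildeEm t) = tildeEm t.
  by rewrite tildeEmE rmorphD /= scal_fix thetabarZ comp_polyC tilde_core_fixed.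
case: Sx => [[a _ <-]|[[]|] ->] //; first exact: thetabar_J.
by rewrite thetabar_com Ep_fix thetabar_J.
Qed.

Lemma left_coideal_generated : left_coideal B.
Proof.
have hB : subalgebra B by exact: generated_subalgebraP.
have SB x : S x -> B x by exact: sub_gen_smallest.
have BJ a : B (J a) by apply: SB; left; exists a.
have hC := coproduct_preimage_subalgebra hB.
have CJ a : tens_right B (coproduct (J a)).
  by apply: coproduct_defect_coideal (BJ a); apply: coproduct_defect_Jgen.
have CEp : tens_right B (coproduct (tildeEp t)).
  apply: coproduct_defect_coideal; last by apply: SB; right; left; left.
  rewrite tildeEpE; apply: coproduct_defectD; apply: coproduct_defectZ.
    exact: coproduct_defect_core.
  exact: coproduct_defect_Jgen.
have CEm : tens_right B (coproduct (tildeEm t)).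
  apply: coproduct_defect_coideal; last by apply: SB; right; left; right.
  rewrite tildeEmE; apply: coproduct_defectD; apply: coproduct_defectZ.
    exact: coproduct_defect_core.
  exact: coproduct_defect_Jgen.
apply: (smallest_sub hC) => x [[a _ <-]|[[]|] ->] //=.
(* The weight-zero generator is a commutator of two elements already treated, so its coproduct is
   not expanded. *)
exact: (com_subalgebra hC CEp (CJ Em)).
Qed.

End TwistedYangian.
End Generators.

Theorem proposition3p5 (R : realType) :
  exists2 phi : R[i] -> R[i], bijective phi &
  forall t : R[i],
    let B : set (Y R[i]) := generated_subalgebra
      (range (@J R[i]) `|` [set tildeEp t; tildeEm t; tildeH t]) in
    [/\ B = twisted_yangian (phi t),
        (forall b, B b -> thetabar b = b) &
        left_coideal B].
Proof.
(* The change between the two normalizations of the parameter; its bijectivity lets every parameter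
   of the general definition occur. *)
exists (fun t => 2^-1 * t + 1).
  by exists (fun s => 2 * (s - 1)) => t; field.
move=> t B; split.
- exact: tilde_subalgebraE.
- exact: thetabar_generated.
- exact: left_coideal_generated.
Qed.
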